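(* Let $\{P_\theta,\theta\in\Theta\}$ be probability measures on a sample space $\mathcal X$, let $\mathcal A\supseteq\Theta$, let $\rho$ be a metric on $\mathcal A$, let $\ell:[0,\infty)\to[0,\infty)$ be nondecreasing, and let $$R:=\inf_{\hat\theta}\sup_{\theta\in\Theta}\mathbb E_\theta\,\ell\big(\rho(\theta,\hat\theta(X))\big)$$ be the minimax risk. With $N(\eta)$, $M_{KL}(\epsilon,\Theta)$, $M_C(\epsilon,\Theta)$ and $M_l(\epsilon,\Theta)$ as defined in the context, the minimax risk satisfies $$R\ \ge\ \sup_{\eta>0,\ \epsilon>0}\ \ell(\eta/2)\,(1-\star),$$ where $\star$ stands for any of the following quantities: $$\frac{\log 2+\log M_{KL}(\epsilon,\Theta)+\epsilon^2}{\log N(\eta)};$$ $$\frac1{N(\eta)}+\sqrt{\frac{(1+\epsilon^2)\,M_C(\epsilon,\Theta)}{N(\eta)}};$$ and, for $l>1$, $l\ne2$, $$\left(\frac1{N(\eta)^{l-1}}+\frac{(1+\epsilon^2)\,M_l(\epsilon,\Theta)^{l-1}}{N(\eta)^{l-1}}\right)^{1/l}.$$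
   Context: In the definition of $R$ the infimum is over all measurable functions $\hat\theta:\mathcal X\to\mathcal A$, and $\mathbb E_\theta$ is expectation when $X\sim P_\theta$. For a convex function $f:[0,\infty)\to\mathbb R$ with $f(1)=0$, the $f$-divergence is $D_f(P\|Q):=\int f\left(\frac{dP}{dQ}\right)dQ$ if $P$ is absolutely continuous with respect to $Q$, and $\infty$ otherwise. (1) For $\eta>0$, $N(\eta)\ge1$ is a real number for which there exists a finite subset $F\subseteq\Theta$ with cardinality $\ge N(\eta)$ satisfying $\rho(\theta,\theta')\ge\eta$ whenever $\theta,\theta'\in F$ and $\theta\ne\theta'$ (that is, $N(\eta)$ is a lower bound on the $\eta$-packing number of $(\Theta,\rho)$). (2) For a convex function $f:[0,\infty)\to\mathbb R$ with $f(1)=0$, a subset $S\subseteq\Theta$ and $\epsilon>0$, $M_f(\epsilon,S)$ is a positive real number for which there exists a finite set $G$ with cardinality $\le M_f(\epsilon,S)$ and probability measures $Q_\alpha$, $\alpha\in G$, on $\mathcal X$ such that $\sup_{\theta\in S}\min_{\alpha\in G}D_f(P_\theta\|Q_\alpha)\le\epsilon^2$. The $Q_\alpha$ need not belong to $\{P_\theta,\theta\in\Theta\}$, and $G$ is just an index set. Write $M_{KL}(\epsilon,S)$, $M_C(\epsilon,S)$, $M_l(\epsilon,S)$ for $M_f(\epsilon,S)$ when $f(x)$ equals $x\log x$ (with $0\log0=0$), $x^2-1$, and $x^l-1$, respectively. The supremum is over those $\eta,\epsilon>0$ for which such numbers exist; in the first bound, $\eta$ with $N(\eta)=1$ (so $\log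 N(\eta)=0$) are disregarded. *)

(* Defs.v *)
From HB Require Import structures.
From mathcomp Require Import all_boot all_order all_algebra finmap.
From mathcomp Require Import all_classical all_reals all_analysis.

Set Implicit Arguments.
Unset Strict Implicit.
Unset Printing Implicit Defensive.

Import Order.TTheory GRing.Theory Num.Theory.

Local Open Scope classical_set_scope.
Local Open Scope ring_scope.
Local Open Scope charge_scope.
Local Open Scope ereal_scope.

(* The action space carries a metric and a sigma-algebra, the latter being
   what "measurable estimator" refers to.  No relation between the two is
   imposed here. *)
#[short(type="measurableMetricType")]
HB.structure Definition MeasurableMetric (d : measure_display)
    (R : numDomainType) := {A of Metric R A & Measurable d A}.

(* Theta is a subset of A, so the family is given as P : A -> probability X R;
   only its values on Theta are used. *)
Definition minimax_risk (R : realType) (dX dA : measure_display)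
    (X : measurableType dX) (A : measurableMetricType dA R)
    (Theta : set A) (P : A -> probability X R) (ell : R -> R) : \bar R :=
  ereal_inf
    [set ereal_sup
           [set 'E_(P theta)[fun x => ell (mdist theta (that x))]
           | theta in Theta]
    | that in [set that : X -> A | measurable_fun setT that]].

(* Meant for f convex on [0, +oo[ with f 1 = 0.  The library's Radon-Nikodym
   derivative is finite everywhere when P `<< Q, but nonnegative only Q-almost
   everywhere: values of f on negative reals do not affect the integral. *)
Definition f_divergence (R : realType) (d : measure_display)
    (X : measurableType d) (f : R -> R) (P Q : probability X R) : \bar R :=
  if `[< P `<< Q >]
  then \int[Q]_x (f (fine (('d (charge_of_finite_measure P) '/d Q) x)))%:E
  else +oo.

Definition kl_fun (R : realType) (x : R) : R := (x * ln x)%R. (* ln 0 = 0 *)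
Definition chi2_fun (R : realType) (x : R) : R := (x ^+ 2 - 1)%R.
Definition power_fun (R : realType) (l x : R) : R := (x `^ l - 1)%R.

(* N is an admissible value of N(eta). *)
Definition packing_lower_bound (R : realType) (A : metricType R)
    (Theta : set A) (eta N : R) : Prop :=
  (1 <= N)%R /\
  exists F : {fset A},
    [/\ [set` F] `<=` Theta,
        (N <= #|` F|%:R)%R &
        forall t t', t \in F -> t' \in F -> t <> t' -> (eta <= mdist t t')%R].

(* M is an admissible value of M_f(eps, S). *)
Definition covering_upper_bound (R : realType) (d : measure_display)
    (X : measurableType d) (A : Type) (P : A -> probability X R)
    (f : R -> R) (eps : R) (S : set A) (M : R) : Prop :=
  (0 < M)%R /\
  exists (G : finType) (Q : G -> probability X R),
    (#|G|%:R <= M)%R /\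
    ereal_sup [set \big[Order.min/+oo]_(a : G) f_divergence f (P t) (Q a)
              | t in S] <= (eps ^+ 2)%:E.

(* sup of ell(eta / 2) (1 - star(eta, eps)) over the pairs (eta, eps) in D *)
Definition sup_bound (R : realType) (ell : R -> R) (D : set (R * R))
    (star : R -> R -> R) : \bar R :=
  ereal_sup [set (ell (p.1 / 2) * (1 - star p.1 p.2))%:E | p in D].

(* Main.v *)
Require Import Defs.
From HB Require Import structures.
From mathcomp Require Import all_boot all_order all_algebra finmap.
From mathcomp Require Import all_classical all_reals all_analysis.
From mathcomp Require Import measurable_realfun ring lra.

Set Implicit Arguments.
Unset Strict Implicit.
Unset Printing Implicit Defensive.

Import Order.TTheory GRing.Theory Num.Theory.

Local Open Scope classical_set_scope.
Local Open Scope ring_scope.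

(** The events that the estimator has loss below ell (eta / 2) at theta, for
    theta in an eta-packing F, are pairwise disjoint sets B_theta; the risk is
    thus at least ell (eta / 2) (1 - p), with p the average over F of
    P_theta B_theta.  If Q_theta is the element of the covering near P_theta,
    then, the B_theta being disjoint, the sum of the Q_theta B_theta is at most
    the size M of the covering.  Integrating an affine minorant of f on B_theta
    and another one on its complement bounds D_f(P_theta || Q_theta) from below
    by an affine function of P_theta B_theta and Q_theta B_theta; averaging over
    F and choosing the minorants suitably yields the bounds on p, with no need for
    Jensen's inequality. *)

(** * Integrating affine minorants against a density *)

(** Positive parts compare as the functions do and negative parts the other way round, so the claim
    holds even when the integral of [f] is infinite. *)
Lemma le_integral_of_integrable_minorant (d : measure_display)
    (T : measurableType d) (R : realType) (mu : {measure set T -> \bar R})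
    (D : set T) (g f : T -> \bar R) :
  measurable D -> mu.-integrable D g -> measurable_fun D f ->
  (forall x, D x -> (g x <= f x)%E) ->
  (\int[mu]_(x in D) g x <= \int[mu]_(x in D) f x)%E.
Proof.
move=> mD ig mf gf.
have mg : measurable_fun D g by exact: measurable_int ig.
have gf' : {in D, forall x, (g x <= f x)%E} by move=> x /set_mem; exact: gf.
rewrite (integralE mu D g) (integralE mu D f); apply: leeB.
- apply: ge0_le_integral => //; [exact: measurable_funepos..|].
  by move=> x Dx; apply: (funepos_le gf'); rewrite inE.
- apply: ge0_le_integral => //; [exact: measurable_funeneg..|].
  by move=> x Dx; apply: (funeneg_le gf'); rewrite inE.
Qed.

Section f_divergence_ge.
Local Open Scope ereal_scope.

(* A two-piece affine minorant of [f], one piece for each of [B] and its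
   complement, replaces the data-processing inequality for the test [B]. *)
Lemma f_divergence_ge (R : realType) (d : measure_display)
    (X : measurableType d) (f : R -> R) (P Q : probability X R) (B : set X)
    (a b u v : R) :
  measurable_fun setT f -> measurable B ->
  (forall x, 0 <= x -> a + b * x <= f x)%R ->
  (forall x, 0 <= x -> (a + u) + (b + v) * x <= f x)%R ->
  (a + b)%:E + u%:E * Q B + v%:E * P B <= f_divergence f P Q.
Proof.
move=> mf mB fC fB; rewrite /f_divergence.
case: asboolP => [PQ|_]; last exact: leey.
(* [h] is a version of the density that is nonnegative everywhere, so that minorants valid on the
   nonnegative reals apply at every point. *)
set h := Radon_Nikodym_SigmaFinite.f P Q.
have h0 x : 0 <= h x by exact: Radon_Nikodym_SigmaFinite.f_ge0.
have hfin x : h x \is a fin_num by exact: Radon_Nikodym_SigmaFinite.f_fin_num.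
have ih : Q.-integrable [set: X] h.
  exact: Radon_Nikodym_SigmaFinite.f_integrable.
have hP E : measurable E -> \int[Q]_(x in E) h x = P E.
  by move=> mE; rewrite -Radon_Nikodym_SigmaFinite.f_integral.
have mfine : measurable_fun [set: \bar R] (fine : \bar R -> R).
  exact: fine_measurable.
have mfh (k : X -> \bar R) : measurable_fun setT k ->
    measurable_fun setT (fun x => (f (fine (k x)))%:E).
  move=> mk; apply/measurable_EFinP.
  by apply: (measurableT_comp mf); exact: measurableT_comp.
have -> : \int[Q]_x (f (fine (Radon_Nikodym (charge_of_finite_measure P) Q x)))%:E
    = \int[Q]_x (f (fine (h x)))%:E.
  apply: ae_eq_integral => //.
  - apply: mfh; apply: (measurable_int Q).
    exact: Radon_Nikodym_integrable.
  - by apply: mfh; exact: (measurable_int Q).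
  - have [N0 [mN QN hN]] := ae_eq_Radon_Nikodym_SigmaFinite PQ measurableT.
    exists N0; split => // x /= hx; apply: hN => /= hx'; apply: hx => _.
    by rewrite /h hx'.
have i1 : Q.-integrable setT (fun x => a%:E * (\1_setT x)%:E).
  by apply: integrableZl => //; exact: integrable_indic.
have i2 : Q.-integrable setT (fun x => b%:E * h x) by exact: integrableZl.
have i3 : Q.-integrable setT (fun x => u%:E * (\1_B x)%:E).
  by apply: integrableZl => //; exact: integrable_indic.
have ihB : Q.-integrable setT (h \_ B).
  apply/integrable_restrict => //; rewrite setTI.
  by apply: (integrableS measurableT).
have i4 : Q.-integrable setT (fun x => v%:E * (h \_ B) x) by exact: integrableZl.
have i12 := integrableD measurableT i1 i2.
have i123 := integrableD measurableT i12 i3.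
have i1234 := integrableD measurableT i123 i4.
(* The integrand is [a + b * h] off [B] and [(a + u) + (b + v) * h] on [B]; [h] integrates to 1 over
   the whole space and to [P B] over [B]. *)
have -> : (a + b)%:E + u%:E * Q B + v%:E * P B =
    \int[Q]_x (a%:E * (\1_setT x)%:E + b%:E * h x
               + u%:E * (\1_B x)%:E + v%:E * (h \_ B) x).
  rewrite (integralD _ i123 i4)// (integralD _ i12 i3)// (integralD _ i1 i2)//.
  rewrite integralZl//; last exact: integrable_indic.
  rewrite integralZl// integralZl//; last exact: integrable_indic.
  rewrite integralZl// !integral_indic// !setIT -integral_mkcond !hP//.
  rewrite EFinD; congr (_ + _ + _ + _).
    by rewrite -[LHS]mule1; congr (_ * _); rewrite -(@probability_setT _ _ _ Q).
  by rewrite (@probability_setT _ _ _ P) mule1.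
apply: (le_integral_of_integrable_minorant measurableT i1234).
  by apply: mfh; exact: (measurable_int Q).
move=> x _; rewrite -(fineK (hfin x)).
have hx0 : (0 <= fine (h x))%R by exact: fine_ge0.
rewrite indicT mule1 indicE patchE.
case: (x \in B); last first.
  by rewrite !mule0 !adde0 -EFinM -EFinD lee_fin; exact: fC.
rewrite mule1 -(fineK (hfin x)) -!EFinM -!EFinD lee_fin /=.
by apply: le_trans (fB _ hx0); rewrite le_eqVlt; apply/orP; left; apply/eqP; ring.
Qed.

End f_divergence_ge.

(** * Disjoint events, coverings and packings *)

Lemma sum_probability_trivIset_le1 (R : realType) (d : measure_display)
    (X : measurableType d) (I : choiceType) (F : {fset I}) (B : I -> set X)
    (Q : probability X R) :
  (forall i, i \in F -> measurable (B i)) -> trivIset [set` F] B ->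
  \sum_(i <- F) fine (Q (B i)) <= 1.
Proof.
move=> mB tB; rewrite -lee_fin -sumEFin.
have -> : (\sum_(i <- F) (fine (Q (B i)))%:E = \sum_(i <- F) Q (B i))%E.
  rewrite big_seq [RHS]big_seq; apply: eq_bigr => i /mB mBi.
  by rewrite fineK// fin_num_measure.
rewrite -measure_fbigsetU//; apply: probability_le1.
by rewrite big_seq; apply: bigsetU_measurable => i /mB.
Qed.

(** Each term is at most its sum over all of [G]; after exchanging the sums, every single [Q g]
    gives the disjoint events total mass at most 1. *)
Lemma sum_probability_trivIset_le_card (R : realType) (d : measure_display)
    (X : measurableType d) (I : choiceType) (F : {fset I}) (B : I -> set X)
    (G : finType) (Q : G -> probability X R) (alpha : I -> G) :
  (forall i, i \in F -> measurable (B i)) -> trivIset [set` F] B ->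
  \sum_(i <- F) fine (Q (alpha i) (B i)) <= #|G|%:R.
Proof.
move=> mB tB; apply: (@le_trans _ _ (\sum_(g : G) \sum_(i <- F) fine (Q g (B i)))).
  rewrite exchange_big /=; apply: ler_sum => i _; rewrite (bigD1 (alpha i))//=.
  by rewrite lerDl; apply: sumr_ge0 => g _; exact: fine_ge0.
rewrite -sum1_card natr_sum; apply: ler_sum => g _.
exact: sum_probability_trivIset_le1.
Qed.

(** Turns the sup-min form of the covering into a choice function. The minimum over an empty [G] is
    [+oo], so a point of [S] forces [G] to be nonempty. *)
Lemma covering_upper_boundP (R : realType) (d : measure_display)
    (X : measurableType d) (A : choiceType) (P : A -> probability X R)
    (f : R -> R) (eps M : R) (S : set A) :
  S !=set0 -> covering_upper_bound P f eps S M ->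
  exists (G : finType) (Q : G -> probability X R) (alpha : A -> G),
    [/\ (0 < #|G|)%N, #|G|%:R <= M &
        forall t, S t -> (f_divergence f (P t) (Q (alpha t)) <= (eps ^+ 2)%:E)%E].
Proof.
move=> [t0 St0] [M0 [G [Q [GM cover]]]].
have near t : S t ->
    exists g, (f_divergence f (P t) (Q g) <= (eps ^+ 2)%:E)%E.
  move=> St; apply: contrapT => /forallNP far; move: cover; apply/negP.
  rewrite -ltNge; apply: (@lt_le_trans _ _
    (\big[Order.min/+oo]_(a : G) f_divergence f (P t) (Q a))%E).
    apply/bigmin_gtP; split => [|g _]; first exact: ltry.
    by rewrite ltNge; apply/negP; exact: far.
  by apply: ereal_sup_ubound; exists t.
(* [g0] is the default value of [alpha] outside [S]. *)
have [g0 _] := near _ St0.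
have /choice[alpha alphaP] t : exists g, S t ->
    (f_divergence f (P t) (Q g) <= (eps ^+ 2)%:E)%E.
  have [/near[g ?]|nSt] := pselect (S t); first by exists g.
  by exists g0.
by exists G, Q, alpha; split => //; apply/card_gt0P; exists g0.
Qed.

(** Sums over [F] the lower bound on the divergence of each [P t] from its covering measure. As
    [u <= 0], the upper bound [M] on the sum of the [Q (alpha t) (B t)] becomes the lower bound
    [u * M] on the terms in [u]. *)
Lemma packing_sum_le (R : realType) (d : measure_display)
    (X : measurableType d) (A : choiceType) (P : A -> probability X R)
    (f : R -> R) (eps M : R) (S : set A) (F : {fset A}) (B : A -> set X)
    (a b u v : R) :
  measurable_fun setT f ->
  (forall x, 0 <= x -> a + b * x <= f x) ->
  (forall x, 0 <= x -> (a + u) + (b + v) * x <= f x) -> u <= 0 ->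
  covering_upper_bound P f eps S M -> S !=set0 -> [set` F] `<=` S ->
  (forall t, t \in F -> measurable (B t)) -> trivIset [set` F] B ->
  #|` F|%:R * (a + b) + u * M + v * \sum_(t <- F) fine (P t (B t))
    <= #|` F|%:R * eps ^+ 2.
Proof.
move=> mf fC fB u0 cover S0 FS mB tB.
have [G [Q [alpha [_ GM div]]]] := covering_upper_boundP S0 cover.
have := sum_probability_trivIset_le_card Q alpha mB tB.
set q := \sum_(_ <- _) _ => qG.
have div_ge t : t \in F ->
    (a + b) + u * fine (Q (alpha t) (B t)) + v * fine (P t (B t)) <= eps ^+ 2.
  move=> tF; have := div _ (FS _ tF).
  move/(le_trans (f_divergence_ge _ _ mf (mB _ tF) fC fB)).
  rewrite -(fineK (fin_num_measure _ _ (mB _ tF))).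
  rewrite -[P t (B t)](fineK (fin_num_measure _ _ (mB _ tF))).
  by rewrite -!EFinM -!EFinD lee_fin.
have : \sum_(t <- F) ((a + b) + u * fine (Q (alpha t) (B t))
    + v * fine (P t (B t))) <= \sum_(t <- F) eps ^+ 2.
  by rewrite big_seq [leRHS]big_seq; apply: ler_sum => t /div_ge.
have sum_cst c : \sum_(t <- F) c = #|` F|%:R * c.
  by rewrite big_const_seq count_predT iter_addr_0 mulr_natl.
rewrite 2!big_split /= !sum_cst -!mulr_sumr -/q => le_sum.
apply: le_trans le_sum; rewrite lerD2r mulrDr lerD2l.
by rewrite ler_wnM2l// (le_trans qG).
Qed.

(** * Reduction of estimation to testing *)

(** An estimate is at distance less than [eta / 2] from at most one point of the packing, so it
    defines disjoint tests. If these succeed with average probability at most [s], some point has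
    error probability at least [1 - s], and an error costs at least [ell (eta / 2)]. *)
Lemma minimax_risk_ge (R : realType) (dX dA : measure_display)
    (X : measurableType dX) (A : measurableMetricType dA R)
    (Theta : set A) (P : A -> probability X R) (ell : R -> R)
    (F : {fset A}) (eta s : R) :
  (forall x, 0 <= x -> 0 <= ell x) ->
  (forall x y, 0 <= x -> x <= y -> ell x <= ell y) ->
  (forall theta, Theta theta ->
     measurable_fun [set: A] (fun a : A => ell (mdist theta a))) ->
  0 <= eta -> (0 < #|` F|)%N -> [set` F] `<=` Theta ->
  (forall t t', t \in F -> t' \in F -> t <> t' -> eta <= mdist t t') ->
  (forall B : A -> set X, (forall t, t \in F -> measurable (B t)) ->
     trivIset [set` F] B ->
     \sum_(t <- F) fine (P t (B t)) <= #|` F|%:R * s) ->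
  ((ell (eta / 2) * (1 - s))%:E <= minimax_risk Theta P ell)%E.
Proof.
move=> ell0 ellM mell eta0 F0 FT sep test.
apply: le_ereal_inf_tmp => _ [that mthat <-].
set c := ell (eta / 2).
have c0 : 0 <= c by apply: ell0; rewrite divr_ge0.
pose L t x := ell (mdist t (that x)).
have mL t : t \in F -> measurable_fun setT (L t).
  move=> tF; apply: (measurableT_comp (mell t _)) => //; exact: FT.
(* Cut out by the loss rather than the distance: measurability comes from that of the loss, and
   monotonicity of [ell] still puts the estimate at distance less than [eta / 2]. *)
pose B t := [set x | L t x < c].
have mB t : t \in F -> measurable (B t).
  move=> tF; rewrite (_ : B t = L t @^-1` `]-oo, c[); last first.
    by apply/seteqP; split => x; rewrite /B /= in_itv.
  by rewrite -[X in measurable X]setTI; exact: mL.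
have near t x : B t x -> mdist t (that x) < eta / 2.
  by rewrite /B /= ltNge [_ < eta / 2]ltNge; apply: contra => ?; apply: ellM => //; rewrite divr_ge0.
have tB : trivIset [set` F] B.
  apply/trivIsetP => t t' tF t'F tt'; apply/seteqP; split => // x [/near h /near h'].
  have := sep _ _ tF t'F (elimN eqP tt'); apply/negP; rewrite -ltNge.
  apply: le_lt_trans (metric_triangle _ (that x) _) _.
  by rewrite [mdist (that x) t']metric_sym; lra.
(* Markov's inequality: the loss dominates [c] times the indicator of the complement of [B t]. *)
have risk t : t \in F -> ((c * (1 - fine (P t (B t))))%:E
    <= 'E_(P t)[fun x => ell (mdist t (that x))])%E.
  move=> tF; rewrite unlock.
  have mBC : measurable (~` B t) by apply: measurableC; exact: mB.
  apply: (@le_trans _ _ (\int[P t]_x (c%:E * (\1_(~` B t) x)%:E))%E).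
    rewrite integralZl//; last exact: integrable_indic.
    rewrite integral_indic// setIT EFinM EFinB fineK; last first.
      by apply: fin_num_measure; exact: mB.
    by rewrite -(probability_setC (P t) (mB t tF)).
  apply: ge0_le_integral => //.
  - by move=> x _; rewrite mule_ge0 ?lee_fin.
  - apply/measurable_EFinP; apply: measurable_funM => //.
  - by apply/measurable_EFinP; exact: mL.
  - move=> x _; rewrite -EFinM lee_fin indicE.
    have [xB|xB] := boolP (x \in ~` B t); last by rewrite mulr0 ell0 ?mdist_ge0.
    by rewrite mulr1; move: xB; rewrite inE /B /= => /negP; rewrite -leNgt.
rewrite leNgt; apply/negP => lt_risk.
have lt_test t : t \in F -> c * (1 - fine (P t (B t))) < c * (1 - s).
  move=> tF; rewrite -lte_fin; apply: le_lt_trans (risk _ tF) _.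
  apply: le_lt_trans lt_risk; apply: ereal_sup_ubound; exists t => //.
  exact: FT.
have := test _ mB tB.
have [t0 t0F] : exists t0, t0 \in F by move: F0; rewrite cardfs_gt0 => /fset0Pn.
(* The strict inequality at [t0] excludes [c = 0], so [c] can be cancelled. *)
have c_gt0 : 0 < c.
  rewrite lt_neqAle c0 andbT; apply/eqP => c00.
  by have := lt_test _ t0F; rewrite -c00 !mul0r ltxx.
apply/negP; rewrite -ltNge.
have lt_s t : t \in F -> s < fine (P t (B t)).
  by move/lt_test; rewrite ltr_pM2l// ltrD2l ltrN2.
have -> : #|` F|%:R * s = \sum_(t <- F) s.
  by rewrite big_const_seq count_predT iter_addr_0 mulr_natl.
rewrite big_seq [ltRHS]big_seq; apply: ltr_sum => //.
by apply/hasP; exists t0.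
Qed.

(** * Affine minorants of the divergence functions *)

(** This is the tangent of slope [y], at the point [expR (y - 1)]; for [x > 0] it lies below the
    graph by [1 + z <= expR z] at [z = y - 1 - ln x]. *)
Lemma kl_fun_minorant (R : realType) (x y : R) :
  0 <= x -> - expR (y - 1) + y * x <= kl_fun x.
Proof.
rewrite /kl_fun le_eqVlt => /predU1P[<-|x0].
  by rewrite mulr0 mul0r addr0 oppr_le0 expR_ge0.
have := expR_ge1Dx (y - 1 - ln x).
rewrite expRD expRN lnK ?posrE// ler_pdivlMr// => tangent.
by rewrite addrC lerBlDr; nra.
Qed.

(* Young's inequality for [x * c `^ (l - 1)]. *)
Lemma power_fun_minorant (R : realType) (l c x : R) :
  1 < l -> 0 <= c -> 0 <= x ->
  -1 - (l - 1) * c `^ l + l * c `^ (l - 1) * x <= power_fun l x.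
Proof.
move=> l1 c0 x0; have l0 : 0 < l by lra.
have lB1 : 0 < l - 1 by rewrite subr_gt0.
have := @conjugate_powR R x (c `^ (l - 1)) l (l / (l - 1)) x0 (powR_ge0 _ _) l0.
rewrite divr_gt0// => /(_ erefl) young.
have /young : l^-1 + (l / (l - 1))^-1 = 1 by field; rewrite !gt_eqF.
have -> : (c `^ (l - 1)) `^ (l / (l - 1)) = c `^ l.
  by rewrite -powRrM; congr (_ `^ _); field; rewrite gt_eqF.
move/(ler_wpM2l (ltW l0)).
have -> : l * (x `^ l / l + c `^ l / (l / (l - 1))) = x `^ l + (l - 1) * c `^ l.
  by field; rewrite !gt_eqF.
by rewrite /power_fun; lra.
Qed.

(** * Bounds on the average success probability of disjoint tests *)

(** Uses the tangents to [x * ln x] at [1 / (2 * M)] off [B t] and at [N / (2 * M)] on it, whose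
    slopes differ by [ln N]. *)
Lemma kl_test_bound (R : realType) (d : measure_display)
    (X : measurableType d) (A : choiceType) (P : A -> probability X R)
    (eps M N : R) (S : set A) (F : {fset A}) (B : A -> set X) :
  covering_upper_bound P (@kl_fun R) eps S M -> S !=set0 -> [set` F] `<=` S ->
  (forall t, t \in F -> measurable (B t)) -> trivIset [set` F] B ->
  1 < N -> N <= #|` F|%:R ->
  \sum_(t <- F) fine (P t (B t))
    <= #|` F|%:R * ((ln 2 + ln M + eps ^+ 2) / ln N).
Proof.
move=> cover S0 FS mB tB N1 NF; set n := #|` F|%:R in NF *.
have M1 : 1 <= M.
  have [G [_ [_ [G0 GM _]]]] := covering_upper_boundP S0 cover.
  by apply: le_trans GM; rewrite ler1n.
have [M0 N0] : 0 < M /\ 0 < N by split; lra.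
have lnN : 0 < ln N by exact: ln_gt0.
set t := ln N; set lam := ln 2 + ln M.
have e0 : expR (- lam) = (2 * M)^-1.
  by rewrite expRN /lam -lnM ?posrE// lnK// posrE mulr_gt0.
have e1 : expR (t - lam) = N * (2 * M)^-1 by rewrite expRD e0 /t lnK ?posrE.
have minorant (y x : R) : 0 <= x -> - expR y + (1 + y) * x <= kl_fun x.
  by move/(kl_fun_minorant (1 + y)); rewrite addrAC subrr add0r.
have mkl : measurable_fun setT (@kl_fun R) by apply: measurable_funM.
have := @packing_sum_le R d X A P (@kl_fun R) eps M S F B
  (- expR (- lam)) (1 - lam) (expR (- lam) - expR (t - lam)) t mkl.
set sum := \sum_(_ <- _) _.
move=> /(_ (minorant _)) bound.
have {}bound := bound _ _ cover S0 FS mB tB.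
rewrite -/n mulrA ler_pdivlMr// [sum * _]mulrC.
have {}bound : n * (- expR (- lam) + (1 - lam))
    + (expR (- lam) - expR (t - lam)) * M + t * sum <= n * eps ^+ 2.
  apply: bound => [x x0|]; last first.
    rewrite subr_le0 ler_expR -[leLHS]add0r lerD2r.
    exact: ltW.
  rewrite addKr (_ : 1 - lam + t = 1 + (t - lam)); last by ring.
  exact: minorant.
move: bound; rewrite e0 e1.
have -> : ((2 * M)^-1 - N * (2 * M)^-1) * M = (1 - N) / 2.
  by field; rewrite gt_eqF.
(* The error terms [n / (2 * M)] and [(N - 1) / 2] are each at most [n / 2], by [1 <= M] and
   [N <= n]; the term [n] coming from the constant 1 in the slopes absorbs both. *)
have : n * (2 * M)^-1 <= n * 2^-1.
  apply: ler_wpM2l; first exact: ler0n.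
  by rewrite lef_pV2 ?posrE; lra.
have : 0 <= n by exact: ler0n.
by move=> *; nra.
Qed.

(** Allowing any [f] above [power_fun l] lets [chi2_fun], written with a natural-number power, be
    treated with [l = 2]. *)
Lemma power_test_bound (R : realType) (d : measure_display)
    (X : measurableType d) (A : choiceType) (P : A -> probability X R)
    (f : R -> R) (l eps M N : R) (S : set A) (F : {fset A}) (B : A -> set X) :
  measurable_fun setT f -> 1 < l ->
  (forall x, 0 <= x -> power_fun l x <= f x) ->
  covering_upper_bound P f eps S M -> S !=set0 -> [set` F] `<=` S ->
  (forall t, t \in F -> measurable (B t)) -> trivIset [set` F] B ->
  0 < N -> N <= #|` F|%:R ->
  \sum_(t <- F) fine (P t (B t))
    <= #|` F|%:R * ((1 + eps ^+ 2) * (M / N) `^ (l - 1)) `^ l^-1.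
Proof.
move=> mf l1 lf cover S0 FS mB tB N0 NF; set n := #|` F|%:R in NF *.
have M0 : 0 < M by case: cover.
have l0 : 0 < l by lra.
set K := 1 + eps ^+ 2; have K0 : 0 < K by rewrite ltr_wpDr// sqr_ge0.
set w := M / N; have w0 : 0 < w by rewrite divr_gt0.
set r := _ `^ l^-1.
have r0 : 0 < r by rewrite powR_gt0// mulr_gt0// powR_gt0.
have rl : r * r `^ (l - 1) = K * w `^ (l - 1).
  rewrite mulr_powRB1// ?ltW// /r -powRrM mulVf ?gt_eqF// powRr1//.
  by rewrite mulr_ge0 ?powR_ge0 ?ltW.
(* the minimizer over c of the bound that the minorants tangent at c give *)
pose c := r / w; have c0 : 0 < c by rewrite divr_gt0.
have cr : c `^ (l - 1) * r = K.
  have wl0 : w `^ (l - 1) != 0 by rewrite gt_eqF ?powR_gt0.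
  apply: (mulIf wl0); rewrite -rl mulrAC -powRM ?ltW//.
  by rewrite /c divfK ?gt_eqF// mulrC.
have clM : c `^ l * M = N * K.
  rewrite -mulr_powRB1 ?ltW// -cr /c /w; field.
  by rewrite !gt_eqF.
(* The minorant is the constant -1 off [B t] and the tangent at [c] on it. *)
have := @packing_sum_le R d X A P f eps M S F B
  (-1) 0 (- ((l - 1) * c `^ l)) (l * c `^ (l - 1)) mf.
set sum := \sum_(_ <- _) _ => bound.
have {}bound : n * (- 1 + 0) + - ((l - 1) * c `^ l) * M
    + l * c `^ (l - 1) * sum <= n * eps ^+ 2.
  apply: bound => // [x x0|x x0|].
  - by rewrite mul0r addr0 (le_trans _ (lf _ x0))// /power_fun lerDr powR_ge0.
  - by rewrite add0r (le_trans _ (lf _ x0))// power_fun_minorant// ltW.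
  - by rewrite oppr_le0 mulr_ge0 ?powR_ge0// subr_ge0 ltW.
have cl0 : 0 < c `^ (l - 1) by rewrite powR_gt0.
(* By [clM] and [N <= n] the covering term costs at most [(l - 1) * (n * K)]; with the [n * K] left
   by the divergences this makes [l * n * K], which [cr] identifies with the right-hand side. *)
suff : l * c `^ (l - 1) * sum <= l * c `^ (l - 1) * (n * r).
  by rewrite ler_pM2l// mulr_gt0.
have -> : l * c `^ (l - 1) * (n * r) = l * n * K by rewrite -cr; ring.
have NK : (l - 1) * (N * K) <= (l - 1) * (n * K).
  by apply: ler_wpM2l; [lra|rewrite ler_pM2r].
move: bound; rewrite mulNr -[(l - 1) * _ * M]mulrA clM.
have -> : n * eps ^+ 2 = n * K - n by rewrite /K; ring.
lra.
Qed.


(** * From test bounds to the minimax bounds *)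

(* Since ell >= 0, it is enough that [star] bounds the average probability of
   correctly testing between the points of a packing. *)
Lemma sup_bound_le_minimax_risk (R : realType) (dX dA : measure_display)
    (X : measurableType dX) (A : measurableMetricType dA R)
    (Theta : set A) (P : A -> probability X R) (ell : R -> R)
    (D : set (R * R)) (star : R -> R -> R) :
  (forall x, 0 <= x -> 0 <= ell x) ->
  (forall x y, 0 <= x -> x <= y -> ell x <= ell y) ->
  (forall theta, Theta theta ->
     measurable_fun [set: A] (fun a : A => ell (mdist theta a))) ->
  (forall p, D p -> [/\ 0 < p.1 & exists2 N, packing_lower_bound Theta p.1 N &
     forall (F : {fset A}) (B : A -> set X),
       Theta !=set0 -> [set` F] `<=` Theta -> N <= #|` F|%:R ->
       (forall t, t \in F -> measurable (B t)) -> trivIset [set` F] B ->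
       \sum_(t <- F) fine (P t (B t)) <= #|` F|%:R * star p.1 p.2]) ->
  (sup_bound ell D star <= minimax_risk Theta P ell)%E.
Proof.
move=> ell0 ellM mell test; apply: ge_ereal_sup => _ [[eta eps] Dp <-] /=.
have [/= eta0 [N [N1 [F [FT NF sep]]] testF]] := test _ Dp.
(* [1 <= N] makes the packing, and hence [Theta], nonempty, as the choice of covering indices
   requires. *)
have F0 : (0 < #|` F|)%N by rewrite -(ltr_nat R); lra.
have [t0 t0F] : exists t0, t0 \in F by move: F0; rewrite cardfs_gt0 => /fset0Pn.
apply: (minimax_risk_ge ell0 ellM mell (ltW eta0) F0 FT sep) => B mB tB.
by apply: testF => //; exists t0; exact: FT.
Qed.

Unset Implicit Arguments.

(* N, MKL, MC and Ml l are arbitrary functions; the suprema range over those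
   (eta, eps) at which their values are admissible. The hypothesis ell_meas
   says that the loss is measurable in the action, as needed for the risk of
   every measurable estimator to make sense; it is automatic when the
   sigma-algebra of A contains the Borel sets. *)
Theorem mainTheorem5 (R : realType) (dX dA : measure_display)
    (X : measurableType dX) (A : measurableMetricType dA R)
    (Theta : set A) (P : A -> probability X R) (ell : R -> R)
    (ell_ge0 : forall x : R, 0 <= x -> 0 <= ell x)
    (ell_nondecreasing : forall x y : R, 0 <= x -> x <= y -> ell x <= ell y)
    (ell_meas : forall theta, Theta theta ->
       measurable_fun [set: A] (fun a : A => ell (mdist theta a)))
    (N MKL MC : R -> R) (Ml : R -> R -> R) :
  [/\ (sup_bound ell
         [set p : R * R | [/\ 0 < p.1, 0 < p.2,
            packing_lower_bound Theta p.1 (N p.1), N p.1 != 1 &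
            covering_upper_bound P (@kl_fun R) p.2 Theta (MKL p.2)]%R]
         (fun eta eps =>
            (ln 2 + ln (MKL eps) + eps ^+ 2) / ln (N eta))%R
       <= minimax_risk Theta P ell)%E,
      (sup_bound ell
         [set p : R * R | [/\ 0 < p.1, 0 < p.2,
            packing_lower_bound Theta p.1 (N p.1) &
            covering_upper_bound P (@chi2_fun R) p.2 Theta (MC p.2)]%R]
         (fun eta eps =>
            (N eta)^-1 + Num.sqrt ((1 + eps ^+ 2) * MC eps / N eta))%R
       <= minimax_risk Theta P ell)%E &
      forall l : R, 1 < l -> l != 2 ->
      (sup_bound ell
         [set p : R * R | [/\ 0 < p.1, 0 < p.2,
            packing_lower_bound Theta p.1 (N p.1) &
            covering_upper_bound P (power_fun l) p.2 Theta (Ml l p.2)]%R]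
         (fun eta eps =>
            ((N eta `^ (l - 1))^-1
             + (1 + eps ^+ 2) * Ml l eps `^ (l - 1) / N eta `^ (l - 1))
            `^ l^-1)%R
       <= minimax_risk Theta P ell)%E].
Proof.
split=> [||l l1 _].
- apply: sup_bound_le_minimax_risk => // -[eta eps] /= [eta0 _ pack N1 cover].
  split=> //; exists (N eta) => // F B T0 FT NF mB tB.
  apply: (kl_test_bound cover T0 FT mB tB) => //.
  by case: pack => N1' _; rewrite lt_neqAle eq_sym N1.
- apply: sup_bound_le_minimax_risk => // -[eta eps] /= [eta0 _ pack cover].
  split=> //; exists (N eta) => // F B T0 FT NF mB tB.
  have N0 : 0 < N eta by case: pack => N1 _; lra.
  have M0 : 0 < MC eps by case: cover.
  have chi2_ge (x : R) : 0 <= x -> power_fun 2 x <= chi2_fun x.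
    by move=> x0; rewrite /power_fun powR_mulrn.
  have mchi2 : measurable_fun setT (@chi2_fun R).
    by apply: measurable_funB => //; exact: measurable_funX.
  have l2 : 1 < 2 :> R by lra.
  have := power_test_bound mchi2 l2 chi2_ge cover T0 FT mB tB N0 NF.
  (* The test bound is the square root, to which the nonnegative term [(N eta)^-1] is added. *)
  move/le_trans; apply; apply: ler_wpM2l => //.
  rewrite (_ : 2 - 1 = 1 :> R); last by ring.
  have w0 : 0 <= MC eps / N eta by rewrite divr_ge0 ?ltW.
  have K0 : 0 <= 1 + eps ^+ 2 by rewrite addr_ge0 ?sqr_ge0.
  rewrite powRr1// powR12_sqrt; last exact: mulr_ge0.
  rewrite mulrA.
  by rewrite lerDr invr_ge0 ltW.
- apply: sup_bound_le_minimax_risk => // -[eta eps] /= [eta0 _ pack cover].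
  split=> //; exists (N eta) => // F B T0 FT NF mB tB.
  have N0 : 0 < N eta by case: pack => N1 _; lra.
  have M0 : 0 < Ml l eps by case: cover.
  have mpow : measurable_fun setT (@power_fun R l).
    by apply: measurable_funB => //; exact: measurable_powR.
  have := power_test_bound mpow l1 (fun _ _ => lexx _) cover T0 FT mB tB N0 NF.
  (* Here the nonnegative summand is added under the nondecreasing power [l^-1]. *)
  move/le_trans; apply; apply: ler_wpM2l => //.
  have NV : (Ml l eps / N eta) `^ (l - 1) = Ml l eps `^ (l - 1) / N eta `^ (l - 1).
    have Nl0 : N eta `^ (l - 1) != 0 by rewrite gt_eqF ?powR_gt0.
    apply: (mulIf Nl0); rewrite divfK// -powRM ?divr_ge0 ?ltW//.
    by rewrite divfK ?gt_eqF.
  have K0 : 0 <= 1 + eps ^+ 2 by rewrite addr_ge0 ?sqr_ge0.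
  rewrite NV mulrA; apply: ge0_ler_powR.
  + by rewrite invr_ge0; lra.
  + by rewrite nnegrE divr_ge0 ?mulr_ge0 ?powR_ge0.
  + by rewrite nnegrE addr_ge0 ?invr_ge0 ?divr_ge0 ?mulr_ge0 ?powR_ge0.
  + by rewrite lerDr invr_ge0 powR_ge0.
Qed.
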